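(* Let $u_h$ be a mesh function on $\mathcal{N}_h$ and let $E$ be a subset of $(\operatorname{Conv}(\mathcal{N}_h))^{\circ}\subset\Omega$. Then $\partial_h u_h(E)=\partial\Gamma(u_h)(E)$ up to a set of Lebesgue measure $0$, and thus $$\omega(R,u_h,E)=\omega(R,\Gamma(u_h),E).$$
   Context: $\Omega\subset\mathbb{R}^d$ is a nonempty bounded convex domain (open) with boundary $\partial\Omega$. For $h>0$: $\mathbb{Z}^d_h=\{mh: m\in\mathbb{Z}^d\}$ and $\Omega_h=\Omega\cap\mathbb{Z}^d_h$, assumed nonempty. $(r_1,\dots,r_d)$ is the canonical basis of $\mathbb{R}^d$. For $x\in\Omega_h$ and $e\in\mathbb{Z}^d$, $h^e_x=\sup\{rh: r\in[0,1],\ x+rhe\in\overline{\Omega}\}$. $V\subset\mathbb{Z}^d$ is a set of directions containing $r_1,\dots,r_d$, with $-e\in V$ whenever $e\in V$, and such that each $e\in V$ is the first element of some basis of $\mathbb{Z}^d$ (the choice $V=\mathbb{Z}^d\setminus\{0\}$ is also allowed). $\partial\Omega_h=\{x\in\partial\Omega: x=y+h^e_y e \text{ for some } y\in\Omega_h, e\in V\}$, $\mathcal{N}_h=\Omega_h\cup\partial\Omega_h$. A mesh function is a function $u_h:\mathcal{N}_h\to\mathbb{R}$. $\operatorname{Conv}$ is the convex hull, $S^\circ$ the interior of $S$. $R$ is a locally integrable function on $\mathbb{R}^d$ such that, for a given convex function $u$ on $\Omega$, $R>0$ on $\partial u(\Omega)$ and $R=0$ on $\mathbb{R}^d\setminus\partial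 u(\Omega)$; here $\partial u(\Omega)=\bigcup_{x_0\in\Omega}\{p\in\mathbb{R}^d: u(x)\ge u(x_0)+p\cdot(x-x_0)\ \forall x\in\Omega\}$. For $x\in\Omega_h$, $\partial_h u_h(x)=\{p\in\mathbb{R}^d: u_h(y)\ge u_h(x)+p\cdot(y-x)\ \forall y\in\mathcal{N}_h\}$ (possibly empty); for $E\subset\Omega$, $\partial_h u_h(E)=\bigcup_{x\in E\cap\mathbb{Z}^d_h}\partial_h u_h(x)$ and $\omega(R,u_h,E)=\int_{\partial_h u_h(E)}R(p)\,dp$. The convex envelope of $u_h$ is $\Gamma(u_h)(x)=\sup\{L(x): L \text{ affine}, L(y)\le u_h(y)\ \forall y\in\mathcal{N}_h\}$. For $x\in(\operatorname{Conv}(\mathcal{N}_h))^\circ$, $\partial\Gamma(u_h)(x)=\{p: \Gamma(u_h)(y)\ge\Gamma(u_h)(x)+p\cdot(y-x)\ \forall y\in\operatorname{Conv}(\mathcal{N}_h)\}$, $\partial\Gamma(u_h)(E)=\bigcup_{x\in E}\partial\Gamma(u_h)(x)$, and $\omega(R,\Gamma(u_h),E)=\int_{\partial\Gamma(u_h)(E)}R(p)\,dp$. *)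

(* Defs.v *)
From HB Require Import structures.
From mathcomp Require Import all_boot all_order all_algebra.
From mathcomp Require Import all_classical all_reals all_analysis.
Import Order.TTheory GRing.Theory Num.Theory.
Import numFieldNormedType.Exports.

Set Implicit Arguments.
Unset Strict Implicit.
Unset Printing Implicit Defensive.

Local Open Scope classical_set_scope.
Local Open Scope ring_scope.

(* Vectors of R^n (n >= 1) are row vectors
   'rV[R]_d.+1, with n = d.+1. *)

(* Lebesgue measure on R^n: the Caratheodory measure of the outer measure
   obtained from countable covers by half-open boxes. Its sigma-algebra is the
   complete one, i.e. that of the Lebesgue measurable sets. *)
Section lebesgue_rV.
Variables (R : realType) (d : nat).
Implicit Types (A : set 'rV[R]_d.+1) (c : 'rV[R]_d.+1 * 'rV[R]_d.+1).

Definition box c : set 'rV[R]_d.+1 :=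
  [set x | forall i, c.1 0 i < x 0 i <= c.2 0 i].

Definition box_volume c : R := \prod_i Num.max 0 (c.2 0 i - c.1 0 i).

Definition box_cover A : set (nat -> 'rV[R]_d.+1 * 'rV[R]_d.+1) :=
  [set c | A `<=` \bigcup_k box (c k)].

Definition lebesgue_outer A : \bar R :=
  ereal_inf [set (\sum_(k <oo) (box_volume (c k))%:E)%E | c in box_cover A].

Local Open Scope ereal_scope.

Let vol_ge0 c : 0 <= (box_volume c)%:E.
Proof. by rewrite lee_fin prodr_ge0// => i _; rewrite le_max lexx. Qed.

Let lebesgue_outer_ge0 A : 0 <= lebesgue_outer A.
Proof. by apply: le_ereal_inf_tmp => _ [c _ <-]; exact: nneseries_ge0. Qed.

Let lebesgue_outer0 : lebesgue_outer set0 = 0.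
Proof.
apply/eqP; rewrite eq_le lebesgue_outer_ge0 andbT.
apply: ereal_inf_lbound; exists (fun=> (0%R, 0%R)) => //.
rewrite eseries0// => k _ _; congr EFin.
by rewrite /box_volume (bigD1 ord0)//= !mxE subrr maxxx mul0r.
Qed.

Let le_lebesgue_outer : {homo lebesgue_outer : A B / A `<=` B >-> A <= B}.
Proof.
move=> A B AB; apply: ereal_inf_le_tmp => _ [c cB <-].
by exists c => //; exact: subset_trans cB.
Qed.

Let lebesgue_outer_sigma_subadditive : sigma_subadditive lebesgue_outer.
Proof.
move=> A; have [[i ioo]|] := pselect (exists i, lebesgue_outer (A i) = +oo).
  rewrite (eseries_pinfty _ _ ioo) ?leey// => n _.
  by rewrite -ltNye (lt_le_trans _ (lebesgue_outer_ge0 _)).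
rewrite -forallNE => Aoo.
suff add2e (e : {posnum R}) : lebesgue_outer (\bigcup_n A n) <=
    \sum_(i <oo) lebesgue_outer (A i) + e%:num%:E.
  by apply/lee_addgt0Pr => _/posnumP[].
rewrite (le_trans _ (epsilon_trick _ _ _))//.
pose P n (c : nat -> _) := box_cover (A n) c /\ \sum_(k <oo) (box_volume (c k))%:E <=
  lebesgue_outer (A n) + (e%:num / (2 ^ n.+1)%:R)%:E.
have [G PG] : {G & forall n, P n (G n)}.
  apply: (@choice _ _ P) => n; rewrite /P.
  have fA : lebesgue_outer (A n) \is a fin_num.
    by rewrite ge0_fin_numE// ltey; exact/eqP.
  have en1 : (0 < e%:num / (2 ^ n.+1)%:R)%R by [].
  have [_ [c cA <-] cS] := lb_ereal_inf_adherent en1 fA.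
  by exists c; split => //; exact: ltW.
pose v ij := (box_volume (uncurry G ij))%:E.
have v_ge0 ij : 0 <= v ij by exact: vol_ge0.
apply: (@le_trans _ _ (\esum_(ij in setT) v ij)).
  apply: ereal_inf_lbound => /=.
  have /card_esym/ppcard_eqP[f] := card_nat2.
  exists (uncurry G \o f).
    move=> t [i _ /(PG i).1[j _ tij]].
    by exists (f^-1%FUN (i, j)) => //=; rewrite invK ?inE.
  rewrite -(esum_pred_image v _ xpredT) ?[fun=> _]set_true//.
  by rewrite image_eq.
rewrite (_ : esum _ _ = \sum_(i <oo) \sum_(j <oo) v (i, j)); last first.
  pose J : nat -> set (nat * nat) := fun i => [set (i, j) | j in setT].
  rewrite (_ : setT = \bigcup_k J k); last first.
    by rewrite predeqE => -[a b]; split => // _; exists a => //; exists b.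
  rewrite esum_bigcupT /=; last 2 first.
    - apply/trivIsetP => i j _ _ ij.
      rewrite predeqE => -[n m] /=; split => //= -[] [_] _ [<-{n} _].
      by move=> [m' _] [] /esym/eqP; rewrite (negbTE ij).
    - by [].
  rewrite -(image_id [set: nat]) -fun_true esum_pred_image//; last first.
    by move=> n _; exact: esum_ge0.
  apply: eq_eseriesr => /= j _.
  rewrite -(esum_pred_image v (pair j) predT)//=; last first.
    by move=> ? ? _ _; exact: (@can_inj _ _ _ snd).
  by congr esum; rewrite predeqE => -[a b]; split; move=> [i _ <-]; exists i.
apply: lee_nneseries => n *; first by exact: nneseries_ge0.
exact: (PG n).2.
Qed.

HB.instance Definition _ := isOuterMeasure.Build R 'rV[R]_d.+1 lebesgue_outer
  lebesgue_outer0 lebesgue_outer_ge0 le_lebesgue_outer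
  lebesgue_outer_sigma_subadditive.

Definition lebesgue_rV : set (caratheodory_type lebesgue_outer) -> \bar R :=
  lebesgue_outer.

HB.instance Definition _ := isMeasure.Build _ _ _ lebesgue_rV
  (@caratheodory_measure0 _ _ _) (@caratheodory_measure_ge0 _ _ _)
  (@caratheodory_measure_sigma_additive _ _ _).

Definition locally_integrable_rV (f : 'rV[R]_d.+1 -> R) :=
  measurable_fun [set: caratheodory_type lebesgue_outer] f /\
  forall K : set 'rV[R]_d.+1, compact K ->
    \int[lebesgue_rV]_(x in K) `|f x|%:E < +oo.

End lebesgue_rV.

Section mesh.
Variables (R : realType) (d : nat).
Local Notation vec := 'rV[R]_d.+1.
Local Notation ivec := 'rV[int]_d.+1.
Implicit Types (Omega N E : set vec) (V : set ivec) (h : R) (p x y : vec).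

Definition dot p x : R := \sum_i p 0 i * x 0 i.

Definition convex_hull N : set vec := smallest (@convex_set R vec) N.

Definition of_int (e : ivec) : vec := map_mx intr e.

Definition lattice h : set vec := [set h *: of_int m | m in [set: ivec]].

Definition int_basis (B : 'I_d.+1 -> ivec) :=
  forall z : ivec, exists! c : ivec, z = \sum_i c 0 i *: B i.

Definition direction_set V :=
  [/\ forall i, V (delta_mx 0 i),
      forall e, V e -> V (- e) &
      forall e, V e -> exists2 B, int_basis B & B ord0 = e]
  \/ V = [set e | e != 0].

Definition interior_mesh Omega h : set vec := Omega `&` lattice h.

(* h^e_x: the step is truncated so that x + h^e_x e stays in closure Omega. *)
Definition mesh_step Omega h (e : ivec) x : R :=
  sup [set r * h | r in
    [set r | 0 <= r <= 1 /\ closure Omega (x + (r * h) *: of_int e)]].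

Definition boundary_mesh Omega h V : set vec :=
  [set x | (closure Omega `\` Omega°) x /\
    exists y e, [/\ interior_mesh Omega h y, V e &
                    x = y + mesh_step Omega h e y *: of_int e]].

Definition mesh Omega h V : set vec :=
  interior_mesh Omega h `|` boundary_mesh Omega h V.

(* Functions on D are total functions whose values outside D are irrelevant.
   With D the convex domain this is the usual subdifferential; with D the set
   of mesh points it is the discrete one. *)
Definition subdiff (D : set vec) (f : vec -> R) x : set vec :=
  [set p | forall y, D y -> f y >= f x + dot p (y - x)].

Definition subdiff_image D f E : set vec := \bigcup_(x in E) subdiff D f x.

Definition discrete_subdiff_image Omega h V (u : vec -> R) E : set vec :=
  subdiff_image (mesh Omega h V) u (E `&` lattice h).

Definition affine (L : vec -> R) := exists p c, forall x, L x = dot p x + c.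

(* Extended-real valued: the supremum is -oo everywhere when u has no affine
   minorant on N, which can happen for infinite N; otherwise it is finite on
   the convex hull of N. *)
Definition convex_envelope N (u : vec -> R) x : \bar R :=
  ereal_sup [set (L x)%:E | L in
    [set L | affine L /\ forall y, N y -> L y <= u y]].

(* As usual in convex analysis, there are no subgradients at a point where the
   envelope is not finite. *)
Definition envelope_subdiff N (u : vec -> R) x : set vec :=
  [set p | convex_envelope N u x \is a fin_num /\
    forall y, convex_hull N y ->
      (convex_envelope N u y >= convex_envelope N u x + (dot p (y - x))%:E)%E].

Definition envelope_subdiff_image N (u : vec -> R) E : set vec :=
  \bigcup_(x in E) envelope_subdiff N u x.

Definition omega (f : vec -> R) (S : set vec) : \bar R :=
  (\int[@lebesgue_rV R d]_(p in S) (f p)%:E)%E.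

End mesh.

(* Main.v *)
Require Import Defs.
From HB Require Import structures.
From mathcomp Require Import all_boot all_order all_algebra.
From mathcomp Require Import all_classical all_reals all_analysis.
From mathcomp Require Import measurable_realfun zify ring lra.
Import Order.TTheory GRing.Theory Num.Theory.
Import numFieldNormedType.Exports.

Set Implicit Arguments.
Unset Strict Implicit.
Unset Printing Implicit Defensive.

Local Open Scope classical_set_scope.
Local Open Scope ring_scope.

(** The proof rests on the duality between the points of Omega and the slopes
    p. Write N for the mesh and, for a slope p, let c be the supremum over the
    y in N of p . y - uh y; it is minus the height at the origin of the highest
    affine function of slope p lying below uh on N. A slope p is a discrete
    subgradient at a mesh point x exactly when that supremum is attained at x,
    and it is a subgradient of the envelope at x exactly when c equals p . x
    minus the envelope at x. Hence a discrete subgradient at x is always a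
    subgradient of the envelope at x (subdiff_sub_envelope), so A is contained
    in B and only B minus A matters.

    On a finite mesh, the supremum for a slope p in B outside A is attained at
    two distinct mesh points y and z, so that p lies on one of the finitely many
    hyperplanes p . (z - y) = uh z - uh y. When the set of directions is
    infinite, the mesh may be infinite, with mesh points accumulating on the
    boundary of Omega; the supremum need not be attained, and the accumulation
    points, by which y and z would be replaced, may be uncountably many.
    Near-maximizers replace maximizers, and rational gaps replace pairs of
    points: split_slopes N u i a b is the set of the slopes whose near-maximizers
    persist both in the half space y_i <= a and in the half space y_i >= b, where
    a < b.

    Such a set is a Lipschitz graph over the hyperplane orthogonal to the i-th
    axis (split_slopes_lipschitz): increasing p_i makes the points on the far
    side of the gap win strictly, at a rate at least b - a, whereas moving the
    other coordinates changes p . y by a bounded multiple of the displacement.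
    A Lipschitz graph is Lebesgue null (lipschitz_graph_null), and there are
    countably many triples (i, a, b) with a and b rational.

    It remains to see that a subgradient p of the envelope at x that lies in no
    split set is in A. Near-maximizers of p surround x, being found in every
    half space with x in its interior (near_max_direction), for otherwise
    tilting the supporting affine function would raise it at x above the
    envelope. As they do not split, they concentrate at x
    (near_max_concentrate). Now x is interior to the convex hull of the mesh,
    hence in Omega (interior_hull_mesh), and the mesh points in Omega are
    lattice points, which are isolated. So the near-maximizers are eventually
    all equal to x: x is a mesh point at which the supremum is attained
    (contact_of_not_split).

    Finally, the density Rd is nonnegative and A and B differ by a null set, so
    the two integrals agree (ge0_integral_setD_negligible). *)

(** * Integrals over domains that differ by a null set *)

Section integral_null.
Local Open Scope ereal_scope.
Import HBNNSimple.
Context (d : measure_display) (T : measurableType d) (R : realType).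
Variable mu : {measure set T -> \bar R}.

(** As A and B may be non-measurable, additivity of the integral cannot be
    invoked. But the integral of a nonnegative function is a supremum over the
    simple functions below it, and cutting such a simple function off on a
    measurable null set keeps its integral. *)
Lemma ge0_integral_setD_negligible (A B : set T) (f : T -> \bar R) :
  (forall x, 0 <= f x) -> A `<=` B -> mu.-negligible (B `\` A) ->
  \int[mu]_(x in A) f x = \int[mu]_(x in B) f x.
Proof.
move=> f0 AB [N [mN N0 BAN]].
rewrite !ge0_integralE//; apply/eqP; rewrite eq_le; apply/andP; split.
  apply: ge_ereal_sup => _ [g /= gf <-]; apply: ereal_sup_ubound.
  exists g => //= x; apply: le_trans (gf x) _.
  by apply: restrict_lee.
apply: ge_ereal_sup => _ [g /= gf <-].
pose g' := proj_nnsfun g (measurableC mN).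
have -> : sintegral mu g = sintegral mu g'.
  rewrite -2!integralT_nnsfun.
  rewrite (@ge0_negligible_integral _ _ _ _ _ N)//; last 2 first.
  - exact/measurable_EFinP.
  - by move=> x _; rewrite lee_fin.
  rewrite setTD integral_mkcond; apply: eq_integral => x _.
  by rewrite /g' /= /patch mindicE; case: (x \in ~` N); rewrite ?mulr1 ?mulr0.
apply: ereal_sup_ubound; exists g' => //= x.
rewrite mindicE; case: (boolP (x \in ~` N)) => [|_]; last first.
  by rewrite mulr0; apply: erestrict_ge0.
rewrite inE /= mulr1 => Nx; apply: le_trans (gf x) _; rewrite /patch.
case: (boolP (x \in B)) => [|_]; last by case: ifP.
rewrite inE => Bx; rewrite mem_set//.
by apply: contrapT => Ax; exact: Nx (BAN _ _).
Qed.

End integral_null.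

(** * Lipschitz graphs are Lebesgue null *)

Section null_sets.
Variables (R : realType) (d : nat).
Local Notation vec := 'rV[R]_d.+1.
Implicit Types (Z : set vec).

Lemma outer_measure_bigsetU (T : Type) (mu : {outer_measure set T -> \bar R})
    (I : finType) (F : I -> set T) :
  (mu (\big[setU/set0]_i F i) <= \sum_i mu (F i))%E.
Proof.
apply: (big_ind2 (fun (A : set T) x => (mu A <= x)%E)) => //.
  by rewrite outer_measure0.
move=> A x B y Ax By; apply: le_trans (outer_measureU2 mu A B) _.
exact: leeD.
Qed.

Lemma lebesgue_outer_box (c : vec * vec) :
  (lebesgue_outer (box c) <= (box_volume c)%:E)%E.
Proof.
have v0 k : (0 <= (box_volume (if k == 0%N then c else (0, 0)))%:E)%E.
  by rewrite lee_fin prodr_ge0// => i _; rewrite le_max lexx.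
apply: ereal_inf_lbound => /=.
exists (fun k => if k == 0%N then c else (0, 0)); first by move=> x cx; exists 0%N.
rewrite (nneseries_split _ 1)//= big_mkord big_ord1 /= eseries0 ?adde0//.
by move=> [|k]// _ _; rewrite /box_volume (bigD1 ord0)//= !mxE subrr maxxx mul0r.
Qed.

Lemma grid_cell (K : nat) (t : R) : 0 < t <= K%:R ->
  exists k : 'I_K, k%:R < t <= k.+1%:R.
Proof.
move=> /andP[t0 tK]; have ex : exists n, t <= n%:R by exists K.
case: (ex_minnP ex) => -[|n] tn nmin; first by move: tn; rewrite leNgt t0.
have nK : (n < K)%N by exact: nmin.
exists (Ordinal nK) => /=; rewrite tn andbT ltNge.
by apply/negP => /nmin; rewrite ltnn.
Qed.

(** The points of Z are determined by their coordinates other than the i-th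
    one, the i-th one being a C-Lipschitz function of them for the sup norm. *)
Definition lipschitz_graph (i : 'I_d.+1) (C : R) Z :=
  forall p q e, Z p -> Z q -> 0 <= e ->
    (forall j, j != i -> `|p 0 j - q 0 j| <= e) -> `|p 0 i - q 0 i| <= C * e.

(** Cut the base (-m, m]^d into K^d cubes of side s = 2 m / K. Above one cube
    the graph stays within C s of any of its points, so a single box of height
    2 (C + 1) s covers it. The total volume is (2 m)^d 2 (C + 1) s, which
    vanishes as K grows. *)
Lemma lipschitz_graph_bounded_null i C Z (m : R) :
  0 <= C -> 0 < m -> lipschitz_graph i C Z ->
  (forall p j, Z p -> - m < p 0 j <= m) -> lebesgue_outer Z = 0%E.
Proof.
move=> C0 m0 ZC Zm; apply/eqP; rewrite eq_le outer_measure_ge0 andbT.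
apply/lee_addgt0Pr => e e0; rewrite add0e.
(* The total volume of the cover by the boxes is A / K. *)
pose A : R := (2 * m) ^+ d * (2 * (C + 1)) * (2 * m).
have A0 : 0 <= A / e.
  by rewrite divr_ge0 ?(ltW e0)// !mulr_ge0 ?exprn_ge0//; lra.
pose K := Num.bound (A / e).
have AK : A / e < K%:R by exact: archi_boundP.
have K0 : 0 < K%:R :> R by exact: le_lt_trans AK.
pose s : R := 2 * m / K%:R.
have s0 : 0 < s by rewrite divr_gt0//; lra.
have sK : s * K%:R = 2 * m by rewrite divfK// gt_eqF.
pose cell (t : {ffun 'I_d -> 'I_K}) : set vec :=
  [set p | forall j, (t j)%:R * s - m < p 0 (lift i j) <= (t j).+1%:R * s - m].
pose v : R := 2 * ((C + 1) * s) * s ^+ d.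
have v0 : 0 <= v by rewrite !mulr_ge0 ?exprn_ge0//; lra.
have cover t : exists c, Z `&` cell t `<=` box c /\ box_volume c <= v.
  have [[q [Zq tq]]|none] := pselect (exists q, Z q /\ cell t q); last first.
    (* No point of Z above the cube: a box of volume zero does. *)
  exists (0, 0); split; first by move=> p [Zp tp]; case: none; exists p.
    by rewrite /box_volume (bigD1 ord0)//= !mxE subrr maxxx mul0r.
  pose lo : vec := \row_j if unlift i j is Some k then (t k)%:R * s - m
                          else q 0 i - (C + 1) * s.
  pose hi : vec := \row_j if unlift i j is Some k then (t k).+1%:R * s - m
                          else q 0 i + (C + 1) * s.
  exists (lo, hi); split => [p [Zp tp] j|].
    rewrite /= !mxE; case: unliftP => [k ->//|->].
    (* Height (C + 1) s rather than C s, because boxes exclude their lower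
       faces. *)
    have : `|p 0 i - q 0 i| <= C * s.
      apply: ZC => //; first exact: ltW.
      move=> k; case: (unliftP i k) => [l -> _|->]; last by rewrite eqxx.
      have := tp l; have := tq l; rewrite -natr1 ler_norml; lra.
    rewrite ler_norml mulrDl; lra.
  rewrite /box_volume (bigD1 i)//= !mxE unlift_none /v.
  rewrite (eq_bigr (fun=> s)); last first.
    move=> j ji; rewrite !mxE; case: unliftP ji => [k -> _|->]; last by rewrite eqxx.
    rewrite -natr1 max_r; lra.
  rewrite prodr_const cardC1 card_ord /=.
  apply: ler_wpM2r; first by rewrite exprn_ge0// ltW.
  by rewrite ge_max; apply/andP; split; rewrite ?mulr_ge0//; lra.
have /choice[c cP] := cover.
have Zc : Z `<=` \big[setU/set0]_t box (c t).
  move=> p Zp.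
  have /choice[t tP] : forall j, exists k : 'I_K,
      k%:R * s - m < p 0 (lift i j) <= k.+1%:R * s - m.
    move=> j; have := Zm p (lift i j) Zp.
    set x := p 0 _ => /andP[mx xm].
    have [|k /andP[kx xk]] := @grid_cell K ((x + m) / s).
      by rewrite divr_gt0//=; [rewrite ler_pdivrMr// mulrC sK; lra|lra].
    by exists k; rewrite ltrBlDr lerBrDr -ltr_pdivlMr// kx -ler_pdivrMr.
  rewrite (bigD1 [ffun j => t j])//=; left.
  apply: (cP _).1; split => // j; rewrite ffunE; exact: tP.
apply: le_trans (le_outer_measure _ _ _ Zc) _.
apply: le_trans (outer_measure_bigsetU _ _) _.
apply: (@le_trans _ _ (\sum_(t : {ffun 'I_d -> 'I_K}) v%:E)%E).
  apply: lee_sum => t _; apply: le_trans (lebesgue_outer_box _) _.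
  by rewrite lee_fin; exact: (cP t).2.
rewrite sumEFin sumr_const card_ffun !card_ord lee_fin -mulr_natl natrX.
have -> : K%:R ^+ d * v = A / K%:R.
  by rewrite /v mulrCA -exprMn [K%:R * s]mulrC sK /A /s; field; rewrite gt_eqF.
by rewrite ler_pdivrMr// mulrC -ler_pdivrMr// ltW.
Qed.

Lemma lipschitz_graph_null i C Z :
  0 <= C -> lipschitz_graph i C Z -> (@lebesgue_rV R d).-negligible Z.
Proof.
move=> C0 ZC.
pose F (n : nat) := Z `&` [set p | forall j, - n.+1%:R < p 0 j <= n.+1%:R].
have -> : Z = \bigcup_n F n.
  apply/seteqP; split => [p Zp|p [n _ []]//].
  exists (Num.bound (\sum_j `|p 0 j|)) => //; split=> // j.
  have h : `|p 0 j| < (Num.bound (\sum_j `|p 0 j|))%:R.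
    apply: le_lt_trans (archi_boundP _); last by rewrite sumr_ge0.
    by rewrite (bigD1 j)//= lerDl sumr_ge0.
  move: h; rewrite ltr_norml -natr1; lra.
apply: negligible_bigcup => n.
have F0 : lebesgue_outer (F n) = 0%E.
  apply: (@lipschitz_graph_bounded_null i C _ n.+1%:R) => //.
    by move=> p q e [Zp _] [Zq _]; exact: ZC.
  by move=> p j [_]; exact.
exists (F n); split => //.
apply: le_caratheodory_measurable => X.
rewrite [Y in (Y + _)%E](_ : _ = 0%E); last first.
  by apply/eqP; rewrite eq_le outer_measure_ge0 andbT -F0 le_outer_measure.
by rewrite add0e le_outer_measure.
Qed.

End null_sets.
(** * The scalar product *)

Section dot_product.
Variables (R : realType) (d : nat).
Local Notation vec := 'rV[R]_d.+1.
Implicit Types p q x y : vec.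

Lemma dotZl (a : R) p x : dot (a *: p) x = a * dot p x.
Proof. by rewrite /dot mulr_sumr; apply: eq_bigr => i _; rewrite !mxE mulrA. Qed.

Lemma dotBr p x y : dot p (x - y) = dot p x - dot p y.
Proof.
by rewrite /dot -sumrB; apply: eq_bigr => i _; rewrite !mxE mulrBr.
Qed.

Lemma dotBl p q x : dot (p - q) x = dot p x - dot q x.
Proof.
by rewrite /dot -sumrB; apply: eq_bigr => i _; rewrite !mxE mulrBl.
Qed.

Lemma dot_delta i x : dot (delta_mx 0 i) x = x 0 i.
Proof.
rewrite /dot (bigD1 i)//= mxE !eqxx mul1r big1 ?addr0// => j ji.
by rewrite mxE (negbTE ji) mul0r.
Qed.

Lemma ler_norm_dot p x (M : R) : (forall i, `|x 0 i| <= M) ->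
  `|dot p x| <= (\sum_i `|p 0 i|) * M.
Proof.
move=> xM; apply: le_trans (ler_norm_sum _ _ _) _; rewrite mulr_suml.
by apply: ler_sum => i _; rewrite normrM ler_wpM2l.
Qed.

End dot_product.

(** * Near-maximizers of a slope *)

Section slopes.
Variables (R : realType) (d : nat).
Local Notation vec := 'rV[R]_d.+1.
Implicit Types (N : set vec) (u : vec -> R) (p q x y : vec) (c e : R).

(** Meant for c the supremum of dot p y - u y over N: the points of N that
    attain it up to e. *)
Definition near_max N u p c e : set vec :=
  [set y | N y /\ c - e < dot p y - u y].

(** The existence of near-maximizers for every e forces c to be the supremum,
    so that p determines c. *)
Definition split_slopes N u (i : 'I_d.+1) (a b : R) : set vec :=
  [set p | exists c, [/\ forall y, N y -> dot p y - u y <= c,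
    forall e, 0 < e -> exists2 y, near_max N u p c e y & y 0 i <= a &
    forall e, 0 < e -> exists2 y, near_max N u p c e y & b <= y 0 i]].

(** Let p and q be two split slopes with p_i < q_i, with suprema c and c'. Test
    c' with a near-maximizer z of p beyond b, and c with a near-maximizer y of q
    below a: then (q - p) . z <= c' - c <= (q - p) . y up to an arbitrarily small
    error, that is, (q - p) . (z - y) <= 0. Its i-th term is at least
    (q_i - p_i) (b - a), and the d other ones are bounded by 2 M |q_j - p_j|. *)
Lemma split_slopes_lipschitz N u i (a b M : R) : a < b ->
  (forall y j, N y -> `|y 0 j| <= M) ->
  lipschitz_graph i (2 * M * d%:R / (b - a)) (split_slopes N u i a b).
Proof.
move=> ab NM.
suff half p q e : split_slopes N u i a b p -> split_slopes N u i a b q ->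
    0 <= e -> (forall j, j != i -> `|p 0 j - q 0 j| <= e) ->
    q 0 i - p 0 i <= 2 * M * d%:R / (b - a) * e.
  move=> p q e Sp Sq e0 pq; rewrite ler_norml.
  have := half p q e Sp Sq e0 pq.
  have /(half q p e Sq Sp e0) : forall j, j != i -> `|q 0 j - p 0 j| <= e.
    by move=> j /pq; rewrite distrC.
  lra.
move=> [c [pc _ pb]] [c' [qc qa _]] e0 pq.
have [qp|pq_i] := leP (q 0 i) (p 0 i).
  apply: le_trans (_ : 0 <= _); first by rewrite subr_le0.
  have [y [Ny _] _] := pb 1 ltr01.
  have M0 : 0 <= M by exact: le_trans (NM y i Ny).
  by rewrite !mulr_ge0// invr_ge0 subr_ge0 ltW.
rewrite mulrAC ler_pdivlMr ?subr_gt0//.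
apply/ler_addgt0Pr => r r0.
have r2 : 0 < r / 2 by lra.
have [z [Nz pz] bz] := pb _ r2; have [y [Ny qy] ya] := qa _ r2.
have h : dot (q - p) (z - y) < r.
  have := qc z Nz; have := pc y Ny; rewrite dotBl !dotBr; lra.
have : (q 0 i - p 0 i) * (b - a) <= (q 0 i - p 0 i) * (z 0 i - y 0 i).
  by apply: ler_wpM2l; lra.
have : `|\sum_(j | j != i) (q - p) 0 j * (z - y) 0 j| <= 2 * M * d%:R * e.
  apply: le_trans (ler_norm_sum _ _ _) _.
  apply: (@le_trans _ _ (\sum_(j < d.+1 | j != i) e * (2 * M))).
    apply: ler_sum => j ji; rewrite normrM; apply: ler_pM => //.
      by rewrite !mxE distrC; exact: pq.
    rewrite !mxE; apply: le_trans (ler_normB _ _) _.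
    have := NM z j Nz; have := NM y j Ny; lra.
  rewrite sumr_const cardC1 card_ord -mulr_natr /=.
  by rewrite le_eqVlt; apply/orP; left; apply/eqP; ring.
move: h; rewrite {1}/dot (bigD1 i)//= !mxE ler_norml; lra.
Qed.

(** The hypothesis on affine minorants says that no affine function below u on
    N exceeds at x the one of slope p and height - c. If all near-maximizers
    were further than x by r in the direction v, then lowering the slope to
    p - t v, for a small t > 0, would leave room to raise the function by
    t (v . x + r) while it stays below u: on the near-maximizers because they
    are far in the direction v, elsewhere because of the margin e. At x this is
    a gain of t r. *)
Lemma near_max_direction N u p x c (M : R) (v : vec) (e r : R) :
  (forall y j, N y -> `|y 0 j| <= M) ->
  (forall y, N y -> dot p y - u y <= c) ->
  (forall L, affine L -> (forall y, N y -> L y <= u y) -> L x <= dot p x - c) ->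
  0 < e -> 0 < r ->
  exists2 y, near_max N u p c e y & dot v y <= dot v x + r.
Proof.
move=> NM pc xc e0 r0; apply: contrapT => none.
have far y : near_max N u p c e y -> dot v x + r < dot v y.
  by move=> Hy; rewrite ltNge; apply/negP => Hv; apply: none; exists y.
(* W bounds v . x + r - v . y on N, so that t W = e is within the margin. *)
pose W : R := `|dot v x| + r + `|(\sum_i `|v 0 i|) * M|.
have W0 : 0 < W by rewrite ltr_pwDl// ltr_wpDl.
pose t := e / W.
have t0 : 0 < t by rewrite divr_gt0.
pose L y := dot (p - t *: v) y + (t * (dot v x + r) - c).
suff minorant y : N y -> L y <= u y.
  have := xc L; rewrite /L dotBl dotZl => /(_ _ minorant).
  have tr0 : 0 < t * r by rewrite mulr_gt0.
  move=> h; have {h} : dot p x - t * dot v x + (t * (dot v x + r) - c) <= dot p x - c.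
    by apply: h; exists (p - t *: v), (t * (dot v x + r) - c).
  rewrite mulrDr; lra.
move=> Ny; rewrite /L dotBl dotZl.
have [near|] := ltP (c - e) (dot p y - u y).
  have : t * (dot v x + r) <= t * dot v y by rewrite ler_pM2l// ltW// far.
  have := pc y Ny; lra.
have : t * (dot v x + r - dot v y) <= e.
  rewrite /t mulrAC ler_pdivrMr// ler_pM2l//.
  have := @ler_norm_dot _ _ v y M (fun j => NM y j Ny).
  have := ler_norm ((\sum_i `|v 0 i|) * M).
  have := ler_norm (dot v x); rewrite /W ler_norml; lra.
rewrite mulrBr; lra.
Qed.

(** Near-maximizers are found on both sides of each hyperplane y_i = x_i, up to
    arbitrarily small distances. If some of them, for every e, also stayed at
    distance r of it, then p would split along a rational gap chosen between x_i
    and x_i + r, or between x_i - r and x_i. *)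
Lemma near_max_concentrate N u p x c (M : R) (r : R) :
  (forall y j, N y -> `|y 0 j| <= M) ->
  (forall y, N y -> dot p y - u y <= c) ->
  (forall L, affine L -> (forall y, N y -> L y <= u y) -> L x <= dot p x - c) ->
  (forall i (a b : rat), ratr a < ratr b :> R ->
    ~ split_slopes N u i (ratr a) (ratr b) p) ->
  0 < r ->
  exists2 e, 0 < e &
    forall y, near_max N u p c e y -> forall i, `|y 0 i - x 0 i| < r.
Proof.
move=> NM pc xc nsplit r0.
have below i s e : 0 < e -> 0 < s ->
    exists2 y, near_max N u p c e y & y 0 i <= x 0 i + s.
  move=> e0 s0.
  have [y Hy] := near_max_direction (delta_mx 0 i) NM pc xc e0 s0.
  by rewrite !dot_delta; exists y.
have above i s e : 0 < e -> 0 < s ->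
    exists2 y, near_max N u p c e y & x 0 i - s <= y 0 i.
  move=> e0 s0.
  have [y Hy] := near_max_direction (-1 *: delta_mx 0 i) NM pc xc e0 s0.
  by rewrite !dotZl !dot_delta; exists y => //; lra.
have right i : exists2 e, 0 < e & forall y, near_max N u p c e y -> y 0 i < x 0 i + r.
  apply: contrapT => none.
  have [b] := @rat_in_itvoo R (x 0 i) (x 0 i + r) ltac:(lra).
  rewrite in_itv /= => /andP[xb br].
  have [a] := rat_in_itvoo xb; rewrite in_itv /= => /andP[xa ab].
  apply: (nsplit i a b ab); exists c; split=> // e e0.
    have [y Hy ya] := below i (ratr a - x 0 i) e e0 ltac:(lra).
    by exists y => //; lra.
  apply: contrapT => none'; apply: none; exists e => // y Hy.
  by rewrite ltNge; apply/negP => ry; apply: none'; exists y => //; lra.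
have left i : exists2 e, 0 < e & forall y, near_max N u p c e y -> x 0 i - r < y 0 i.
  apply: contrapT => none.
  have [a] := @rat_in_itvoo R (x 0 i - r) (x 0 i) ltac:(lra).
  rewrite in_itv /= => /andP[ra ax].
  have [b] := rat_in_itvoo ax; rewrite in_itv /= => /andP[ab bx].
  apply: (nsplit i a b ab); exists c; split=> // e e0; last first.
    have [y Hy yb] := above i (x 0 i - ratr b) e e0 ltac:(lra).
    by exists y => //; lra.
  apply: contrapT => none'; apply: none; exists e => // y Hy.
  by rewrite ltNge; apply/negP => ry; apply: none'; exists y => //; lra.
have /choice[e eP] : forall i, exists e, 0 < e /\
    forall y, near_max N u p c e y -> `|y 0 i - x 0 i| < r.
  move=> i; have [e1 e10 h1] := right i; have [e2 e20 h2] := left i.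
  exists (Num.min e1 e2); split; first by rewrite lt_min e10.
  move=> y [Ny hy].
  have : y 0 i < x 0 i + r.
    by apply: h1; split=> //; apply: le_lt_trans hy; rewrite lerB// ge_min lexx.
  have : x 0 i - r < y 0 i.
    by apply: h2; split=> //; apply: le_lt_trans hy; rewrite lerB// ge_min lexx orbT.
  rewrite ltr_norml; lra.
exists (\big[Num.min/1]_i e i).
  by apply/lt_bigmin => // [i _]; exact: (eP i).1.
move=> y [Ny hy] i; apply: (eP i).2; split=> //.
by apply: le_lt_trans hy; rewrite lerB// bigmin_le_cond.
Qed.

(** Near-maximizers concentrate at x, and N has at most one point near x, hence
    all near-maximizers are eventually one and the same point: it attains the
    supremum, and it is x. *)
Lemma contact_of_not_split N u p x c (M : R) (r : R) :
  (forall y j, N y -> `|y 0 j| <= M) ->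
  (forall y, N y -> dot p y - u y <= c) ->
  (forall L, affine L -> (forall y, N y -> L y <= u y) -> L x <= dot p x - c) ->
  (forall i (a b : rat), ratr a < ratr b :> R ->
    ~ split_slopes N u i (ratr a) (ratr b) p) ->
  0 < r ->
  (forall y z, N y -> N z -> (forall i, `|y 0 i - x 0 i| < r) ->
    (forall i, `|z 0 i - x 0 i| < r) -> y = z) ->
  N x /\ u x = dot p x - c.
Proof.
move=> NM pc xc nsplit r0 iso.
have conc := near_max_concentrate NM pc xc nsplit.
have [e e0 eP] := conc r r0.
have near e' : 0 < e' -> near_max N u p c e' !=set0.
  by move=> e'0; have [y Hy _] := near_max_direction 0 NM pc xc e'0 r0; exists y.
have [y Hy] := near e e0.
have same z : near_max N u p c e z -> z = y.
  by move=> Hz; apply: iso; [exact: Hz.1|exact: Hy.1|exact: eP|exact: eP].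
have all e' : 0 < e' -> near_max N u p c e' y.
  move=> e'0.
  have m0 : 0 < Num.min e e' by rewrite lt_min e0.
  have [z [Nz hz]] := near _ m0.
  have zy : z = y.
    by apply: same; split=> //; apply: le_lt_trans hz; rewrite lerB// ge_min lexx.
  split; first exact: Hy.1.
  by rewrite -zy; apply: le_lt_trans hz; rewrite lerB// ge_min lexx orbT.
have yx : y = x.
  apply/rowP => i; apply/eqP; rewrite -subr_eq0 -normr_le0.
  apply/ler_addgt0Pr => s s0; rewrite add0r.
  have [e' e'0 h] := conc s s0; apply/ltW/h; exact: all.
rewrite -yx; split; first exact: Hy.1.
suff : c <= dot p y - u y by have := pc y Hy.1; lra.
apply/ler_addgt0Pr => s s0; have := (all s s0).2; lra.
Qed.

End slopes.
(** * Closures of convex sets *)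

Section convex_sets.
Variables (R : realType) (V : normedModType R).
Implicit Types (A : set V) (x y z : V).

Lemma closure_norm A x :
  closure A x <-> forall e : R, 0 < e -> exists2 a, A a & `|x - a| < e.
Proof.
split=> [Ax e e0|Ax B /nbhs_ballP[e /= e0 eB]].
  have [a [Aa xa]] := Ax _ (nbhsx_ballx x e e0).
  by exists a => //; move: xa; rewrite -ball_normE.
have [a Aa xa] := Ax e e0.
by exists a; split => //; apply: eB; rewrite -ball_normE.
Qed.

Lemma convex_set_segment A x y (k : R) : convex_set A -> 0 <= k -> k <= 1 ->
  A x -> A y -> A (k *: x + (1 - k) *: y).
Proof.
move=> cA k0 k1 Ax Ay.
by have := cA x y (Itv01 k0 k1); rewrite !inE; exact.
Qed.

Lemma convex_closure A : convex_set A -> convex_set (closure A).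
Proof.
move=> cA x y k; rewrite !inE => Ax Ay; apply/closure_norm => e e0.
have [a Aa xa] := (closure_norm A x).1 Ax e e0.
have [b Ab yb] := (closure_norm A y).1 Ay e e0.
have k0 : 0 <= k%:num by exact: ge0.
have k1 : k%:num <= 1 by exact: le1.
exists (k%:num *: a + (1 - k%:num) *: b); first exact: convex_set_segment.
rewrite [X in `|X|](_ : _ = k%:num *: (x - a) + (1 - k%:num) *: (y - b)); last first.
  by rewrite !scalerBr opprD addrACA.
apply: le_lt_trans (ler_normD _ _) _; rewrite !normrZ.
rewrite (ger0_norm k0) (@ger0_norm _ (1 - _)) ?subr_ge0//.
have [->|kn] := eqVneq k%:num 0; first by rewrite mul0r add0r subr0 mul1r.
have : k%:num * `|x - a| < k%:num * e by rewrite ltr_pM2l// lt_neqAle eq_sym kn.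
have : (1 - k%:num) * `|y - b| <= (1 - k%:num) * e by rewrite ler_wpM2l ?subr_ge0// ltW.
lra.
Qed.

(** Extend the segment from a point x0 of A to x slightly beyond x, up to a
    point z still in the closure of A. Replacing z by a nearby z' in A, and x0
    by the point w that compensates for the change, which is in A as A is open,
    exhibits x as a convex combination of z' and w. *)
Lemma interior_closure_convex A : open A -> convex_set A -> A !=set0 ->
  (closure A)° `<=` A.
Proof.
move=> oA cA [x0 Ax0] x /nbhs_ballP[e /= e0 xe].
have [r /= r0 Ax0_r] : exists2 r : R, 0 < r & ball x0 r `<=` A.
  by apply/nbhs_ballP; exact: open_nbhs_nbhs.
pose t := e / (`|x - x0| + 1) / 2.
have n0 : 0 < `|x - x0| + 1 by rewrite ltr_wpDl.
have t0 : 0 < t by rewrite !divr_gt0.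
pose z := x + t *: (x - x0).
have Az : closure A z.
  apply: xe; rewrite -ball_normE /= /z opprD addNKr normrN normrZ gtr0_norm//.
  have : t * (`|x - x0| + 1) = e / 2 by rewrite /t; field; rewrite gt_eqF.
  rewrite mulrDr; lra.
have tr0 : 0 < t * r by rewrite mulr_gt0.
have [z' Az' zz'] := (closure_norm A z).1 Az _ tr0.
pose w := x0 + t^-1 *: (z - z').
have Ax0' : A w.
  apply: Ax0_r; rewrite -ball_normE /= /w opprD addNKr normrN normrZ.
  by rewrite gtr0_norm ?invr_gt0// mulrC ltr_pdivrMr// mulrC.
have s0 : 0 < 1 + t by lra.
have -> : x = (1 + t)^-1 *: z' + (1 - (1 + t)^-1) *: w.
  apply: (@scalerI _ _ (1 + t)); first by rewrite gt_eqF.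
  rewrite scalerDr !scalerA mulfV ?gt_eqF// scale1r.
  rewrite mulrBr mulr1 mulfV ?gt_eqF// addrAC subrr add0r.
  rewrite /w scalerDr scalerA mulfV ?gt_eqF// scale1r /z.
  rewrite scalerDl scale1r scalerBr.
  by rewrite addrCA [z' + _]addrC subrK addrCA [t *: x0 + _]addrC subrK.
apply: convex_set_segment => //; first by rewrite invr_ge0 ltW.
by rewrite invf_le1//; lra.
Qed.

End convex_sets.
(** * Meshes, envelopes and their subdifferentials *)

Section meshes.
Variables (R : realType) (d : nat).
Local Notation vec := 'rV[R]_d.+1.
Implicit Types (Omega N E : set vec) (V : set 'rV[int]_d.+1) (u L : vec -> R).
Implicit Types p x y z : vec.

Lemma ler_coord_norm (x : vec) i : `|x 0 i| <= `|x|.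
Proof. by rewrite [leRHS]mx_normrE (le_bigmax _ (fun ij => `|x ij.1 ij.2|) (0, i)). Qed.

Lemma bounded_coord Omega : bounded_set Omega ->
  exists M, forall y i, closure Omega y -> `|y 0 i| <= M.
Proof.
move=> [M [_ OM]]; exists (M + 2) => y i /closure_norm /(_ 1 ltr01)[a Oa ya].
have aM : `|a| <= M + 1 by apply: (OM (M + 1)) => //; lra.
apply: le_trans (ler_coord_norm y i) _.
have := ler_normD (y - a) a; rewrite subrK; lra.
Qed.

Lemma mesh_sub_closure Omega h V : mesh Omega h V `<=` closure Omega.
Proof.
by move=> y [[Oy _]|[[]]//]; exact: subset_closure.
Qed.

(** The other mesh points lie on the boundary of Omega, which Omega, being
    open, does not meet. *)
Lemma mesh_lattice Omega h V y : open Omega ->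
  mesh Omega h V y -> Omega y -> lattice h y.
Proof.
move=> oO [[]//|[[_ nOy] _] Oy]; case: nOy.
by rewrite (interior_id _).1.
Qed.

Lemma interior_hull_mesh Omega h V :
  open Omega -> convex_set Omega -> Omega !=set0 ->
  (convex_hull (mesh Omega h V))° `<=` Omega.
Proof.
move=> oO cO O0; apply: subset_trans (interior_closure_convex oO cO O0).
apply: interiorS; apply: smallest_sub; first exact: convex_closure.
exact: mesh_sub_closure.
Qed.

Lemma lattice_isolated h (y z : vec) : lattice h y -> lattice h z ->
  (forall i, `|y 0 i - z 0 i| < h) -> y = z.
Proof.
move=> [m _ <-] [n _ <-] mn; congr (_ *: _); apply/rowP => i; rewrite !mxE.
have := mn i; rewrite !mxE -mulrBr normrM -intrB -intr_norm => lt_h.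
have h0 : 0 < `|h|.
  rewrite normr_gt0; apply/eqP => h0.
  by move: lt_h; rewrite h0 normr0 mul0r ltxx.
have : `|m 0 i - n 0 i|%:~R < 1 :> R.
  rewrite -(ltr_pM2l h0) mulr1; exact: lt_le_trans lt_h (ler_norm h).
rewrite ltrz1 => lt1; congr (_%:~R); move: (m 0 i) (n 0 i) lt1 => a b; lia.
Qed.

Lemma affine_dot p (c : R) : affine (fun x : vec => dot p x + c).
Proof. by exists p, c. Qed.

Lemma affine_le_envelope N u L x : affine L -> (forall y, N y -> L y <= u y) ->
  ((L x)%:E <= convex_envelope N u x)%E.
Proof. by move=> aL Lu; apply: ereal_sup_ubound; exists L. Qed.

Lemma convex_envelope_le N u x : N x -> (convex_envelope N u x <= (u x)%:E)%E.
Proof. by move=> Nx; apply: ge_ereal_sup => _ [L [_ Lu] <-]; rewrite lee_fin Lu. Qed.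

(** A discrete subgradient p at x provides an affine minorant that touches u at
    x, so the envelope equals u at x and lies above that minorant. *)
Lemma subdiff_sub_envelope N u x : N x -> subdiff N u x `<=` envelope_subdiff N u x.
Proof.
move=> Nx p px.
have below y : ((u x + dot p (y - x))%:E <= convex_envelope N u y)%E.
  have -> : u x + dot p (y - x) = dot p y + (u x - dot p x) by rewrite dotBr; ring.
  apply: (@affine_le_envelope _ _ (fun y => dot p y + (u x - dot p x))).
    exact: affine_dot.
  by move=> z /px; rewrite dotBr; lra.
have Gx : convex_envelope N u x = (u x)%:E.
  apply/eqP; rewrite eq_le convex_envelope_le//=.
  by have := below x; rewrite dotBr subrr addr0.
by split=> [|y _]; rewrite Gx// -EFinD.
Qed.

(** With g the value of the envelope at x, the number c = p . x - g bounds
    p . y - u y on N since p is a subgradient, and no affine minorant exceeds g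
    at x by definition of the envelope. *)
Lemma envelope_subdiff_contact N u x p (M r : R) :
  (forall y j, N y -> `|y 0 j| <= M) ->
  0 < r ->
  (forall y z, N y -> N z -> (forall i, `|y 0 i - x 0 i| < r) ->
    (forall i, `|z 0 i - x 0 i| < r) -> y = z) ->
  envelope_subdiff N u x p ->
  (forall i (a b : rat), ratr a < ratr b :> R ->
    ~ split_slopes N u i (ratr a) (ratr b) p) ->
  N x /\ subdiff N u x p.
Proof.
move=> NM r0 iso [+ Gp] nsplit.
case G : (convex_envelope N u x) Gp => [g| |]// Gp _.
have pg y : N y -> dot p y - u y <= dot p x - g.
  move=> Ny; have /Gp : convex_hull N y by exact: sub_gen_smallest.
  rewrite -EFinD => /le_trans /(_ (convex_envelope_le u Ny)).
  by rewrite lee_fin dotBr; lra.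
have [|Nx ux] := contact_of_not_split NM pg _ nsplit r0 iso.
  move=> L aL Lu; have := affine_le_envelope x aL Lu.
  by rewrite G lee_fin; lra.
split=> // y Ny; have := pg y Ny; rewrite dotBr ux; lra.
Qed.

Lemma split_slopes_negligible N u (M : R) :
  (forall y j, N y -> `|y 0 j| <= M) -> 0 <= M ->
  (@lebesgue_rV R d).-negligible
    [set p | exists i (a b : rat),
       ratr a < ratr b :> R /\ split_slopes N u i (ratr a) (ratr b) p].
Proof.
move=> NM M0.
pose F n := [set p | exists i (a b : rat), [/\ unpickle n = Some (i, a, b),
  ratr a < ratr b :> R & split_slopes N u i (ratr a) (ratr b) p]].
suff : (@lebesgue_rV R d).-negligible (\bigcup_n F n).
  apply: negligibleS => p [i [a [b [ab sp]]]]; exists (pickle (i, a, b)) => //.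
  by exists i, a, b; rewrite pickleK.
apply: negligible_bigcup => n.
case E : (unpickle n : option ('I_d.+1 * rat * rat)) => [[[i a] b]|]; last first.
  apply: negligibleS (negligible_set0 _) => p [i [a [b []]]].
  by rewrite E.
have [ab|ab] := ltP (ratr a : R) (ratr b); last first.
  apply: negligibleS (negligible_set0 _) => p [i' [a' [b' []]]].
  by rewrite E => -[_ <- <-]; rewrite ltNge ab.
have C0 : 0 <= 2 * M * d%:R / (ratr b - ratr a).
  by rewrite !mulr_ge0// invr_ge0 subr_ge0 ltW.
have FS : F n `<=` split_slopes N u i (ratr a) (ratr b).
  by move=> p [i' [a' [b' []]]]; rewrite E => -[<- <- <-].
have := lipschitz_graph_null C0 (split_slopes_lipschitz (u := u) (i := i) ab NM).
by apply: negligibleS.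
Qed.

End meshes.

Theorem theorem4 (R : realType) (d : nat)
  (Omega : set 'rV[R]_d.+1)
  (Omega_open : open Omega) (Omega_nonempty : Omega !=set0)
  (Omega_bounded : bounded_set Omega) (Omega_convex : convex_set Omega)
  (h : R) (h_gt0 : 0 < h) (mesh_nonempty : interior_mesh Omega h !=set0)
  (V : set 'rV[int]_d.+1) (V_dir : direction_set V)
  (u : 'rV[R]_d.+1 -> R) (u_convex : convex_function Omega u)
  (Rd : 'rV[R]_d.+1 -> R) (Rd_locint : locally_integrable_rV Rd)
  (Rd_gt0 : forall p, subdiff_image Omega u Omega p -> 0 < Rd p)
  (Rd_eq0 : forall p, ~ subdiff_image Omega u Omega p -> Rd p = 0)
  (uh : 'rV[R]_d.+1 -> R) (E : set 'rV[R]_d.+1)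
  (E_sub : E `<=` (convex_hull (mesh Omega h V))°) :
  let A := discrete_subdiff_image Omega h V uh E in
  let B := envelope_subdiff_image (mesh Omega h V) uh E in
  [/\ (convex_hull (mesh Omega h V))° `<=` Omega,
      (@lebesgue_rV R d).-negligible (A `+` B) &
      omega Rd A = omega Rd B].
Proof.
move=> A B.
have hullO := @interior_hull_mesh _ _ _ h V Omega_open Omega_convex Omega_nonempty.
have [M clM] := bounded_coord Omega_bounded.
have NM y j : mesh Omega h V y -> `|y 0 j| <= M.
  by move=> /mesh_sub_closure; exact: clM.
have AB : A `<=` B.
  move=> p [x [Ex Lx] px]; exists x => //; apply: subdiff_sub_envelope px.
  by left; split=> //; exact/hullO/E_sub.
have negBA : (@lebesgue_rV R d).-negligible (B `\` A).
  have M0 : 0 <= M.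
    have [y [Oy _]] := mesh_nonempty.
    exact: le_trans (normr_ge0 _) (clM y ord0 (subset_closure Oy)).
  have := split_slopes_negligible uh NM M0.
  apply: negligibleS => p [[x Ex xp] nAp]; apply: contrapT => nsplit; apply: nAp.
  have Ox : Omega x by exact/hullO/E_sub.
  have [s /= s0 sO] : exists2 s : R, 0 < s & ball x s `<=` Omega.
    by apply/nbhs_ballP; exact: open_nbhs_nbhs.
  pose r := Num.min s (h / 2).
  have r0 : 0 < r by rewrite lt_min s0 divr_gt0.
  have near_lattice y : mesh Omega h V y -> (forall i, `|y 0 i - x 0 i| < r) ->
      lattice h y.
    move=> Ny yx; apply: mesh_lattice (Ny) _ => //; apply: sO; split=> // i j.
    rewrite ord1 -ball_normE /= distrC.
    by apply: lt_le_trans (yx j) _; rewrite ge_min lexx.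
  have [|//|Nx sub] := @envelope_subdiff_contact _ _ _ uh x p M r NM r0 _ xp.
  - move=> y z Ny Nz yx zx.
    apply: lattice_isolated (near_lattice y Ny yx) (near_lattice z Nz zx) _ => i.
    have rh : r <= h / 2 by rewrite ge_min lexx orbT.
    have := yx i; have := zx i; rewrite !ltr_norml; lra.
  - by move=> i a b ab sp; apply: nsplit; exists i, a, b.
  exists x => //; split=> //; exact: mesh_lattice Omega_open Nx Ox.
split=> //.
  by move: negBA; apply: negligibleS => p [[/AB]|].
apply: ge0_integral_setD_negligible => // p; rewrite lee_fin.
have [/Rd_gt0/ltW//|/Rd_eq0->//] := pselect (subdiff_image Omega u Omega p).
Qed.
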